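(* For every integer $n \ge 1$ (with $2n+1$ not necessarily prime), there exists a diregular tournament on $2n+1$ points that can be decomposed into $n$ disjoint directed Hamilton circuits; that is, there exist $n$ pairwise edge-disjoint directed Hamilton circuits in it such that every directed edge of the tournament belongs to exactly one of these circuits.
   Context: A tournament is a digraph without loops in which every pair of distinct vertices is joined by exactly one directed edge. A diregular tournament on $2n+1$ points is a tournament on $2n+1$ vertices in which every vertex has in-degree $n$ and out-degree $n$. A directed Hamilton circuit of a digraph is a directed cycle, following the directions of the edges, that passes through every vertex exactly once. Here ''disjoint'' circuits means that no two of them share a directed edge. *)

(* Defs.v *)
From mathcomp Require Import all_boot.

Set Implicit Arguments.
Unset Strict Implicit.
Unset Printing Implicit Defensive.

(* A digraph on a finite vertex set T is given by its adjacency relation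
   e : rel T; the directed edge from x to y is present iff e x y holds. *)

Section Tournaments.

Variable T : finType.
Implicit Types (e : rel T) (c : seq T).

Definition tournament e : Prop :=
  irreflexive e /\ (forall x y, x != y -> e x y (+) e y x).

Definition out_degree e (x : T) : nat := #|[set y | e x y]|.
Definition in_degree e (x : T) : nat := #|[set y | e y x]|.

Definition diregular_tournament e (n : nat) : Prop :=
  [/\ tournament e, #|T| = (2 * n).+1 &
      forall x, in_degree e x = n /\ out_degree e x = n].

(* A circuit is represented by the list of its vertices in cyclic order, the
   last vertex being followed by the first. *)
Definition hamilton_circuit e c : Prop :=
  ucycle e c /\ (forall x, x \in c).

Definition circuit_edges c : {set T * T} :=
  [set p | (p.1 \in c) && (next c p.1 == p.2)].

Definition hamilton_decomposition e (n : nat) (C : 'I_n -> seq T) : Prop :=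
  [/\ forall i, hamilton_circuit e (C i),
      forall i j, i != j ->
        [disjoint circuit_edges (C i) & circuit_edges (C j)] &
      forall x y, e x y -> exists! i, (x, y) \in circuit_edges (C i)].

End Tournaments.

(* Main.v *)
Require Import Defs.
From mathcomp Require Import all_boot.
From mathcomp Require Import zify.

(** The construction is Walecki's decomposition of the complete graph on 2n+1
    vertices.  Take as vertices the residues modulo 2n together with one extra
    point, infinity.  The zigzag 0, -1, 1, -2, 2, ... runs once through all
    residues, and its consecutive terms have sum -1 or 0 alternately.  Closing
    it through infinity gives a Hamilton circuit; translating the residues by
    i < n gives n circuits.  In the i-th one an edge between two residues has
    sum 2i-1 or 2i, and the neighbours of infinity are i and i+n.  So the two
    ends of an edge, in either order, determine the circuit that contains it:
    this is the symmetric function [edge_label].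

    The rest is counting ([decomposition_of_labelling]).  Orient every circuit
    along itself and let e be the union.  At a vertex x the n successors are
    distinct, the n predecessors are distinct, and no successor is also a
    predecessor, since the two edges would lie in the same circuit, of length
    at least 3.  These 2n vertices, all different from x, exhaust the others,
    so every pair is joined in exactly one direction and e is diregular. *)

(** * Circuits separated by a symmetric labelling *)

Section Labelling.

Variable T : finType.

Lemma next_neq (c : seq T) (x : T) :
  uniq c -> 1 < size c -> x \in c -> next c x != x.
Proof.
move=> Uc sz_c xc; case: (rot_to xc) => k s Dc.
rewrite -(next_rot k Uc) Dc.
have: uniq (x :: s) by rewrite -Dc rot_uniq.
have: 1 < size (x :: s) by rewrite -Dc size_rot.
case: s {Dc} => [//|y s] _ /= /andP[].
by rewrite inE negb_or eqxx eq_sym => /andP[].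
Qed.

(** After rotating c so that x comes first, the successor of x is the second
    entry and its predecessor the last one. *)
Lemma next_neq_prev (c : seq T) (x : T) :
  uniq c -> 2 < size c -> x \in c -> next c x != prev c x.
Proof.
move=> Uc sz_c xc; case: (rot_to xc) => k s Dc.
rewrite -(next_rot k Uc) -(prev_rot k Uc) Dc.
have: uniq (x :: s) by rewrite -Dc rot_uniq.
have: 2 < size (x :: s) by rewrite -Dc size_rot.
case: s {Dc} => [//|y [//|z s]] _ Us.
have prev_last : prev [:: x, y, z & s] x = last z s.
  have Ux : x \notin [:: y, z & s] by case/andP: Us.
  rewrite -[RHS]/(last x [:: y, z & s]).
  move: Ux; rewrite /= !inE !negb_or => /and3P[/negPf-> /negPf-> Ux].
  elim: s z Ux {Us} => [|w s IHs] z /=; first by rewrite eqxx.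
  by rewrite inE negb_or => /andP[/negPf-> /IHs].
rewrite prev_last /= eqxx; apply/eqP => Dy.
by case/and3P: Us => _; rewrite Dy mem_last.
Qed.

Variables (n : nat) (C : 'I_n -> seq T) (lab : T -> T -> nat).

Hypothesis card_T : #|T| = (2 * n).+1.
Hypothesis uniqC : forall i, uniq (C i).
Hypothesis memC : forall i x, x \in C i.
Hypothesis lab_sym : forall x y, lab x y = lab y x.
Hypothesis lab_next : forall i x, lab x (next (C i) x) = i.

Definition circuit_union : rel T := fun x y => [exists i, next (C i) x == y].

Let sizeC i : size (C i) = (2 * n).+1.
Proof.
rewrite -card_T -(card_uniqP (uniqC i)).
by apply: eq_card => x; rewrite memC.
Qed.

Let lab_prev i x : lab x (prev (C i) x) = i.
Proof. by rewrite lab_sym -[X in lab _ X](next_prev (uniqC i)) lab_next. Qed.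

Let succs x := [set next (C i) x | i : 'I_n].
Let preds x := [set prev (C i) x | i : 'I_n].

Let succsE x y : (y \in succs x) = circuit_union x y.
Proof.
by apply/imsetP/existsP => [[i _ ->]|[i /eqP <-]]; exists i.
Qed.

Let predsE x y : (y \in preds x) = circuit_union y x.
Proof.
apply/imsetP/existsP => [[i _ ->]|[i /eqP <-]]; exists i => //.
  by rewrite next_prev.
by rewrite prev_next.
Qed.

Let card_succs x : #|succs x| = n.
Proof.
rewrite card_imset ?card_ord // => i j eq_ij.
by apply: val_inj; rewrite /= -(lab_next i x) eq_ij lab_next.
Qed.

Let card_preds x : #|preds x| = n.
Proof.
rewrite card_imset ?card_ord // => i j eq_ij.
by apply: val_inj; rewrite /= -(lab_prev i x) eq_ij lab_prev.
Qed.

Let union_irr : irreflexive circuit_union.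
Proof.
move=> x; rewrite /circuit_union; apply/existsP => -[i]; apply/negP.
by apply: next_neq => //; rewrite sizeC; have := ltn_ord i; lia.
Qed.

Let union_asym x y : circuit_union x y -> ~~ circuit_union y x.
Proof.
rewrite -(predsE x y) /circuit_union => /existsP[i /eqP Dy].
apply/imsetP => -[j _ Dy'].
have eq_ij : i = j.
  by apply: val_inj; rewrite /= -(lab_next i x) Dy Dy' lab_prev.
suff /eqP[] : next (C i) x != prev (C i) x by rewrite Dy Dy' eq_ij.
by apply: next_neq_prev => //; rewrite sizeC; have := ltn_ord i; lia.
Qed.

(** Totality is where the number of vertices enters: successors and
    predecessors of x are 2n distinct vertices other than x. *)
Let union_total x y : x != y -> circuit_union x y || circuit_union y x.
Proof.
move=> neq_xy; rewrite -succsE -predsE -in_setU.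
have sub : succs x :|: preds x \subset [set~ x].
  apply/subsetP => z; rewrite !inE succsE predsE.
  by case: eqP => // ->; rewrite union_irr.
have disj : succs x :&: preds x = set0.
  apply/setP => z; rewrite !inE succsE predsE.
  by apply/andP => -[/union_asym/negP].
have /eqP -> : succs x :|: preds x == [set~ x].
  by rewrite eqEcard sub cardsC1 cardsU disj cards0 card_succs card_preds
             card_T /=; lia.
by rewrite !inE eq_sym.
Qed.

(** The label of an edge names the only circuit that can contain it, so the
    circuits are disjoint even as undirected graphs. *)
Lemma decomposition_of_labelling :
  diregular_tournament circuit_union n /\
  hamilton_decomposition circuit_union C.
Proof.
split; split=> //.
- split=> // x y /union_total.
  case: (boolP (circuit_union x y)) => [exy _|_ /= eyx]; last by rewrite eyx.
  by rewrite (negPf (union_asym x y exy)).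
- move=> x; split; [rewrite -[RHS](card_preds x) | rewrite -[RHS](card_succs x)];
    by apply: eq_card => y; rewrite inE ?predsE ?succsE.
- move=> i; split=> //; apply/andP; split=> //.
  apply: cycle_from_next => // x _; apply/existsP; by exists i.
- move=> i j; apply: contraNT => /pred0Pn[[x y]] /andP[] /=.
  rewrite !inE !memC /= => /eqP Di /eqP Dj.
  by apply/eqP/val_inj; rewrite /= -(lab_next i x) Di -Dj lab_next.
- move=> x y; rewrite /circuit_union => /existsP[i next_i]; exists i; split.
    by rewrite inE memC.
  move=> j; rewrite inE memC /= => /eqP next_j; apply: val_inj.
  by rewrite /= -(lab_next i x) (eqP next_i) -next_j lab_next.
Qed.

End Labelling.

(** * Walecki's zigzag circuits *)

(** The sequence 0, 2n-1, 1, 2n-2, ..., that is 0, -1, 1, -2, ... modulo 2n. *)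
Definition zigzag (n k : nat) : nat := if odd k then 2 * n - uphalf k else k./2.

Lemma zigzag_lt n k : k < 2 * n -> zigzag n k < 2 * n.
Proof. by rewrite /zigzag => lt_k; case: ifP => odd_k; lia. Qed.

(** Even positions fill the lower half of the residues, odd positions the
    upper half. *)
Lemma zigzag_inj n k l :
  k < 2 * n -> l < 2 * n -> zigzag n k = zigzag n l -> k = l.
Proof.
by rewrite /zigzag => lt_k lt_l; case: ifP => odd_k; case: ifP => odd_l; lia.
Qed.

(** Two consecutive terms add up to 2n-1 or 2n; the rounding in [uphalf]
    identifies these sums. *)
Lemma uphalf_zigzag n i k : k.+1 < 2 * n ->
  uphalf ((i + zigzag n k) + (i + zigzag n k.+1)) = n + i.
Proof. by rewrite /zigzag /= => lt_k; case odd_k: (odd k) => /=; lia. Qed.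

(** Adding 2n to a term shifts the rounded half of a sum by n, so working with
    residues modulo 2n is compatible with labels modulo n. *)
Lemma uphalf_modD n a b :
  uphalf (a %% (2 * n) + b %% (2 * n)) = uphalf (a + b) %[mod n].
Proof.
rewrite {2}(divn_eq a (2 * n)) {2}(divn_eq b (2 * n)).
set q := a %/ _; set r := b %/ _; set a' := a %% _; set b' := b %% _.
have -> : uphalf (q * (2 * n) + a' + (r * (2 * n) + b'))
          = (q + r) * n + uphalf (a' + b').
  have -> : q * (2 * n) + a' + (r * (2 * n) + b')
            = ((q + r) * n).*2 + (a' + b') by lia.
  by lia.
by rewrite modnMDl.
Qed.

Section Walecki.

Variable n : nat.
Hypothesis n_gt0 : 0 < n.

Notation vertex := 'I_(2 * n).+1.

(* The vertices below 2n are the residues; [ord_max] is the point at infinity. *)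

Definition zigzag_vertex (i k : nat) : vertex :=
  inord ((i + zigzag n k) %% (2 * n)).

Definition walecki_circuit (i : nat) : seq vertex :=
  ord_max :: mkseq (zigzag_vertex i) (2 * n).

(** The index of the circuit through the edge xy.  The sums 2i-1 and 2i both
    have rounded half i, and infinity is adjacent to i and i+n, which agree
    modulo n. *)
Definition edge_label (x y : vertex) : nat :=
  (if x == ord_max then y : nat
   else if y == ord_max then x : nat else uphalf (x + y)) %% n.

Lemma edge_labelC x y : edge_label x y = edge_label y x.
Proof.
rewrite /edge_label addnC.
by case: (x =P ord_max) => [->|_] //; case: eqP => [->|].
Qed.

Lemma zigzag_vertexE i k :
  zigzag_vertex i k = (i + zigzag n k) %% (2 * n) :> nat.
Proof. by rewrite inordK // ltnS ltnW // ltn_pmod // muln_gt0. Qed.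

Lemma zigzag_vertex_neq_max i k : (zigzag_vertex i k == ord_max) = false.
Proof.
apply/negP => /eqP/(congr1 val) /=; rewrite zigzag_vertexE => eq_2n.
by have := @ltn_pmod (i + zigzag n k) (2 * n); rewrite eq_2n ltnn; lia.
Qed.

Lemma walecki_circuit_uniq i : uniq (walecki_circuit i).
Proof.
rewrite /walecki_circuit /=; apply/andP; split.
  by apply/negP => /mapP[k _ /esym/eqP]; rewrite zigzag_vertex_neq_max.
rewrite map_inj_in_uniq ?iota_uniq // => k l.
rewrite !mem_iota /= !add0n => lt_k lt_l /(congr1 val) /=.
rewrite !zigzag_vertexE => /eqP; rewrite eqn_modDl !modn_small ?zigzag_lt //.
by move=> /eqP; apply: zigzag_inj.
Qed.

Lemma mem_walecki_circuit i x : x \in walecki_circuit i.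
Proof.
have sub : {subset walecki_circuit i <= enum vertex}.
  by move=> y _; rewrite mem_enum.
have le_size : size (enum vertex) <= size (walecki_circuit i).
  by rewrite -cardE card_ord /= size_mkseq.
by have [_ ->] := uniq_min_size (walecki_circuit_uniq i) sub le_size;
   rewrite mem_enum.
Qed.

Lemma walecki_circuit_label i : i < n ->
  cycle (fun x y => edge_label x y == i) (walecki_circuit i).
Proof.
move=> lt_in; rewrite /walecki_circuit /cycle; apply/(pathP ord_max) => k.
rewrite size_rcons size_mkseq ltnS => le_k; rewrite nth_rcons size_mkseq.
have lt_i2n : i < 2 * n by lia.
case: k le_k => [_|k le_k].
  rewrite /= muln_gt0 n_gt0 /= nth_mkseq ?muln_gt0 // /edge_label eqxx.
  by rewrite zigzag_vertexE /zigzag /= addn0 !modn_small.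
rewrite [nth _ (_ :: _) _]/= nth_rcons size_mkseq le_k nth_mkseq //.
have [lt_k|gt_k|eq_k] := ltngtP k.+1 (2 * n); [| by lia |].
  rewrite nth_mkseq // /edge_label !zigzag_vertex_neq_max !zigzag_vertexE.
  by rewrite uphalf_modD uphalf_zigzag // modnDl modn_small.
(* The zigzag ends at n, so the circuit returns to infinity from i + n. *)
rewrite /edge_label zigzag_vertex_neq_max eqxx zigzag_vertexE.
have -> : zigzag n k = n by rewrite /zigzag; case: ifP => odd_k; lia.
have lt_in2n : i + n < 2 * n by lia.
by rewrite (modn_small lt_in2n) modnDr modn_small.
Qed.

End Walecki.

Theorem theorem2p2 (n : nat) (n_ge1 : 1 <= n) :
  exists e : rel 'I_(2 * n).+1,
    diregular_tournament e n /\
    exists C : 'I_n -> seq 'I_(2 * n).+1, hamilton_decomposition e C.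
Proof.
pose C (i : 'I_n) := walecki_circuit n i.
have [] := @decomposition_of_labelling _ n C (edge_label n).
- by rewrite card_ord.
- by move=> i; apply: walecki_circuit_uniq.
- by move=> i x; apply: mem_walecki_circuit.
- exact: edge_labelC.
- move=> i x; apply/eqP.
  apply: (next_cycle (walecki_circuit_label n n_ge1 i (ltn_ord i))).
  exact: mem_walecki_circuit.
by move=> diregular decomp; exists (circuit_union _ n C); split=> //; exists C.
Qed.
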